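(* Let $F$ be a field of characteristic $0$ and $n\ge 1$. For elements $a,a_1,\ldots,a_n$ of an alternative $F$-algebra put $$u_n(a;a_1,\ldots,a_n)=\bigl([a,a_1,\ldots,a_{n-1}],a^2,a_n\bigr)-\bigl([a^2,a_1,\ldots,a_{n-1}],a,a_n\bigr).$$ For any $a,a_1,\ldots,a_n\in Alt[X]$, the element $u_n(a;a_1,\ldots,a_n)$ lies in the ideal of $Alt[X]$ generated by the elements $u_n(a;x_{i_1},\ldots,x_{i_n})$ with $x_{i_1},\ldots,x_{i_n}\in X$. In particular, any $n$-generated alternative $F$-algebra satisfies the identity $u_{n+1}=0$, i.e. $u_{n+1}(a;a_1,\ldots,a_{n+1})=0$ for all elements $a,a_1,\ldots,a_{n+1}$ of the algebra.
   Context: $X=\{x_1,x_2,\ldots\}$ is a countably infinite set of free generators and $Alt[X]$ is the free alternative $F$-algebra on $X$. Commutator $[p,q]=pq-qp$; long commutators are left-normed, $[p,q_1,\ldots,q_k]=[\ldots[[p,q_1],q_2],\ldots,q_k]$ (equal to $p$ if $k=0$). Associator: $(p,q,r)=(pq)r-p(qr)$. *)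

(* Defs.v *)
From HB Require Import structures.
From mathcomp Require Import all_boot all_algebra.
From mathcomp Require Import boolp classical_sets.

Set Implicit Arguments.
Unset Strict Implicit.
Unset Printing Implicit Defensive.

Import GRing.Theory.
Local Open Scope ring_scope.
Local Open Scope quotient_scope.

Declare Scope na_scope.
Delimit Scope na_scope with NA.

(* Algebras are neither assumed associative nor unital.                       *)
HB.mixin Record Lmodule_isNAAlgebra (F : fieldType) A of GRing.Lmodule F A := {
  namul : A -> A -> A;
  namulDl : forall x y z : A, namul (x + y) z = namul x z + namul y z;
  namulDr : forall x y z : A, namul x (y + z) = namul x y + namul x z;
  namulZl : forall (c : F) (x y : A), namul (c *: x) y = c *: namul x y;
  namulZr : forall (c : F) (x y : A), namul x (c *: y) = c *: namul x y
}.

#[short(type="naAlgType")]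
HB.structure Definition NAAlgebra (F : fieldType) :=
  {A of Lmodule_isNAAlgebra F A & GRing.Lmodule F A}.

Notation "x ** y" := (namul x y) (at level 40, left associativity) : na_scope.
Local Open Scope na_scope.

Definition nacomm (F : fieldType) (A : naAlgType F) (p q : A) : A :=
  p ** q - q ** p.

Definition naassoc (F : fieldType) (A : naAlgType F) (p q r : A) : A :=
  (p ** q) ** r - p ** (q ** r).

Definition long_comm (F : fieldType) (A : naAlgType F) (p : A) (s : seq A) : A :=
  foldl (@nacomm F A) p s.

(* For n > 0 and t = (a_1, ..., a_n), [take n.-1 t] is the sequence           *)
(* a_1, ..., a_{n-1} and [last 0 t] is a_n.                                   *)
Definition u_elt (F : fieldType) (A : naAlgType F) (n : nat) (a : A)
    (t : n.-tuple A) : A :=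
  naassoc (long_comm a (take n.-1 t)) (a ** a) (last 0 t)
  - naassoc (long_comm (a ** a) (take n.-1 t)) a (last 0 t).

HB.mixin Record NAAlgebra_isAlternative (F : fieldType) A of NAAlgebra F A := {
  naassoc_xxy : forall x y : A, naassoc x x y = 0;
  naassoc_yxx : forall x y : A, naassoc y x x = 0
}.

#[short(type="altAlgType")]
HB.structure Definition AltAlgebra (F : fieldType) :=
  {A of NAAlgebra_isAlternative F A & NAAlgebra F A}.

Section Substructures.
Variables (F : fieldType) (A : naAlgType F).

Definition is_subspace (S : set A) : Prop :=
  [/\ S 0, forall x y, S x -> S y -> S (x + y)
    & forall (c : F) x, S x -> S (c *: x)].

Definition is_subalgebra (S : set A) : Prop :=
  is_subspace S /\ forall x y, S x -> S y -> S (x ** y).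

Definition is_ideal (I : set A) : Prop :=
  is_subspace I /\ forall x y, I x -> I (x ** y) /\ I (y ** x).

Definition ideal_gen (G : set A) : set A := smallest is_ideal G.

Definition subalgebra_gen (G : set A) : set A := smallest is_subalgebra G.

(* The n generators need not be distinct.                                     *)
Definition n_generated (n : nat) : Prop :=
  exists g : 'I_n -> A, subalgebra_gen (range g) = setT.

End Substructures.

Section FreeAlternative.
Variables (F : fieldType) (X : Type).

Inductive alt_term : Type :=
| TVar of X
| TZero
| TOpp of alt_term
| TAdd of alt_term & alt_term
| TScale of F & alt_term
| TMul of alt_term & alt_term.

(* The congruence generated by the defining identities of alternative         *)
(* F-algebras; the free algebra is the quotient of the terms by it.           *)
Inductive alt_eq : alt_term -> alt_term -> Prop :=
| AE_refl x : alt_eq x x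
| AE_sym x y : alt_eq x y -> alt_eq y x
| AE_trans x y z : alt_eq x y -> alt_eq y z -> alt_eq x z
| AE_opp x x' : alt_eq x x' -> alt_eq (TOpp x) (TOpp x')
| AE_add x x' y y' :
    alt_eq x x' -> alt_eq y y' -> alt_eq (TAdd x y) (TAdd x' y')
| AE_scale c x x' : alt_eq x x' -> alt_eq (TScale c x) (TScale c x')
| AE_mul x x' y y' :
    alt_eq x x' -> alt_eq y y' -> alt_eq (TMul x y) (TMul x' y')
| AE_addA x y z : alt_eq (TAdd x (TAdd y z)) (TAdd (TAdd x y) z)
| AE_addC x y : alt_eq (TAdd x y) (TAdd y x)
| AE_add0 x : alt_eq (TAdd TZero x) x
| AE_addN x : alt_eq (TAdd (TOpp x) x) TZero
| AE_scaleA c d x : alt_eq (TScale c (TScale d x)) (TScale (c * d) x)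
| AE_scale1 x : alt_eq (TScale 1 x) x
| AE_scaleDr c x y :
    alt_eq (TScale c (TAdd x y)) (TAdd (TScale c x) (TScale c y))
| AE_scaleDl c d x :
    alt_eq (TScale (c + d) x) (TAdd (TScale c x) (TScale d x))
| AE_mulDl x y z : alt_eq (TMul (TAdd x y) z) (TAdd (TMul x z) (TMul y z))
| AE_mulDr x y z : alt_eq (TMul x (TAdd y z)) (TAdd (TMul x y) (TMul x z))
| AE_mulZl c x y : alt_eq (TMul (TScale c x) y) (TScale c (TMul x y))
| AE_mulZr c x y : alt_eq (TMul x (TScale c y)) (TScale c (TMul x y))
| AE_xxy x y : alt_eq (TMul (TMul x x) y) (TMul x (TMul x y))
| AE_yxx x y : alt_eq (TMul (TMul y x) x) (TMul y (TMul x x)).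

HB.instance Definition _ := gen_eqMixin alt_term.
HB.instance Definition _ := gen_choiceMixin alt_term.

Definition alt_eqb (x y : alt_term) : bool := `[< alt_eq x y >].

Lemma alt_eqb_refl : reflexive alt_eqb.
Proof. by move=> x; apply/asboolP; apply: AE_refl. Qed.

Lemma alt_eqb_sym : symmetric alt_eqb.
Proof. by move=> x y; apply/asboolP/asboolP; apply: AE_sym. Qed.

Lemma alt_eqb_trans : transitive alt_eqb.
Proof.
by move=> y x z /asboolP xy /asboolP yz; apply/asboolP; apply: AE_trans xy yz.
Qed.

Canonical alt_eqb_equiv := EquivRel alt_eqb alt_eqb_refl alt_eqb_sym alt_eqb_trans.

Definition free_alt : Type := {eq_quot alt_eqb}.

HB.instance Definition _ := Choice.on free_alt.

Definition fa_class (t : alt_term) : free_alt := \pi_{eq_quot alt_eqb} t.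
Definition fa_repr (x : free_alt) : alt_term := repr (x : {eq_quot alt_eqb}).

Lemma fa_reprK x : fa_class (fa_repr x) = x.
Proof. exact: reprK. Qed.

Lemma fa_classP s t : fa_class s = fa_class t <-> alt_eq s t.
Proof.
by split=> [/eqmodP/asboolP | st] //; apply/eqmodP; apply/asboolP.
Qed.

Lemma fa_repr_class t : alt_eq (fa_repr (fa_class t)) t.
Proof. by apply/fa_classP; rewrite fa_reprK. Qed.

Definition fa_gen (i : X) : free_alt := fa_class (TVar i).
Definition fa_zero : free_alt := fa_class TZero.
Definition fa_opp x : free_alt := fa_class (TOpp (fa_repr x)).
Definition fa_add x y : free_alt := fa_class (TAdd (fa_repr x) (fa_repr y)).
Definition fa_scale c x : free_alt := fa_class (TScale c (fa_repr x)).
Definition fa_mul x y : free_alt := fa_class (TMul (fa_repr x) (fa_repr y)).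

Lemma fa_oppE t : fa_opp (fa_class t) = fa_class (TOpp t).
Proof. by apply/fa_classP; apply: AE_opp; apply: fa_repr_class. Qed.
Lemma fa_addE s t : fa_add (fa_class s) (fa_class t) = fa_class (TAdd s t).
Proof. by apply/fa_classP; apply: AE_add; apply: fa_repr_class. Qed.
Lemma fa_scaleE c t : fa_scale c (fa_class t) = fa_class (TScale c t).
Proof. by apply/fa_classP; apply: AE_scale; apply: fa_repr_class. Qed.
Lemma fa_mulE s t : fa_mul (fa_class s) (fa_class t) = fa_class (TMul s t).
Proof. by apply/fa_classP; apply: AE_mul; apply: fa_repr_class. Qed.

Let faE := (fa_oppE, fa_addE, fa_scaleE, fa_mulE).

Lemma fa_ind (P : free_alt -> Prop) : (forall t, P (fa_class t)) -> forall x, P x.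
Proof. by move=> Pc x; rewrite -(fa_reprK x). Qed.

Lemma fa_addA : associative fa_add.
Proof.
elim/fa_ind=> x; elim/fa_ind=> y; elim/fa_ind=> z.
by rewrite !faE; apply/fa_classP; apply: AE_addA.
Qed.
Lemma fa_addC : commutative fa_add.
Proof.
elim/fa_ind=> x; elim/fa_ind=> y.
by rewrite !faE; apply/fa_classP; apply: AE_addC.
Qed.
Lemma fa_add0 : left_id fa_zero fa_add.
Proof. by elim/fa_ind=> x; rewrite !faE; apply/fa_classP; apply: AE_add0. Qed.
Lemma fa_addN : left_inverse fa_zero fa_opp fa_add.
Proof. by elim/fa_ind=> x; rewrite !faE; apply/fa_classP; apply: AE_addN. Qed.

HB.instance Definition _ :=
  GRing.isZmodule.Build free_alt fa_addA fa_addC fa_add0 fa_addN.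

Lemma fa_scaleA c d x : fa_scale c (fa_scale d x) = fa_scale (c * d) x.
Proof.
by elim/fa_ind: x => x; rewrite !faE; apply/fa_classP; apply: AE_scaleA.
Qed.
Lemma fa_scale1 : left_id 1 fa_scale.
Proof. by elim/fa_ind=> x; rewrite !faE; apply/fa_classP; apply: AE_scale1. Qed.
Lemma fa_scaleDr : right_distributive fa_scale +%R.
Proof.
move=> c; elim/fa_ind=> x; elim/fa_ind=> y; rewrite /GRing.add /= !faE.
by apply/fa_classP; apply: AE_scaleDr.
Qed.
Lemma fa_scaleDl x : {morph fa_scale^~ x : c d / c + d}.
Proof.
move=> c d; elim/fa_ind: x => x; rewrite /= [RHS]/GRing.add /= !faE.
by apply/fa_classP; apply: AE_scaleDl.
Qed.

HB.instance Definition _ := GRing.Zmodule_isLmodule.Build F free_alt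
  fa_scaleA fa_scale1 fa_scaleDr fa_scaleDl.

Lemma fa_mulDl (x y z : free_alt) : fa_mul (x + y) z = fa_mul x z + fa_mul y z.
Proof.
elim/fa_ind: x => x; elim/fa_ind: y => y; elim/fa_ind: z => z.
by rewrite /GRing.add /= !faE; apply/fa_classP; apply: AE_mulDl.
Qed.
Lemma fa_mulDr (x y z : free_alt) : fa_mul x (y + z) = fa_mul x y + fa_mul x z.
Proof.
elim/fa_ind: x => x; elim/fa_ind: y => y; elim/fa_ind: z => z.
by rewrite /GRing.add /= !faE; apply/fa_classP; apply: AE_mulDr.
Qed.
Lemma fa_mulZl c (x y : free_alt) : fa_mul (c *: x) y = c *: fa_mul x y.
Proof.
elim/fa_ind: x => x; elim/fa_ind: y => y.
by rewrite /GRing.scale /= !faE; apply/fa_classP; apply: AE_mulZl.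
Qed.
Lemma fa_mulZr c (x y : free_alt) : fa_mul x (c *: y) = c *: fa_mul x y.
Proof.
elim/fa_ind: x => x; elim/fa_ind: y => y.
by rewrite /GRing.scale /= !faE; apply/fa_classP; apply: AE_mulZr.
Qed.

HB.instance Definition _ := Lmodule_isNAAlgebra.Build F free_alt
  fa_mulDl fa_mulDr fa_mulZl fa_mulZr.

Lemma fa_xxy (x y : free_alt) : naassoc x x y = 0.
Proof.
apply/eqP; rewrite subr_eq0; apply/eqP; elim/fa_ind: x => x; elim/fa_ind: y => y.
by rewrite /namul /= !faE; apply/fa_classP; apply: AE_xxy.
Qed.
Lemma fa_yxx (x y : free_alt) : naassoc y x x = 0.
Proof.
apply/eqP; rewrite subr_eq0; apply/eqP; elim/fa_ind: x => x; elim/fa_ind: y => y.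
by rewrite /namul /= !faE; apply/fa_classP; apply: AE_yxx.
Qed.

HB.instance Definition _ := NAAlgebra_isAlternative.Build F free_alt
  fa_xxy fa_yxx.

Section UniversalProperty.
Variables (B : altAlgType F) (g : X -> B).

Fixpoint term_eval (t : alt_term) : B :=
  match t with
  | TVar i => g i
  | TZero => 0
  | TOpp x => - term_eval x
  | TAdd x y => term_eval x + term_eval y
  | TScale c x => c *: term_eval x
  | TMul x y => term_eval x ** term_eval y
  end.

Lemma term_eval_eq s t : alt_eq s t -> term_eval s = term_eval t.
Proof.
elim=> //= {s t}.
- by move=> x y z _ -> _ ->.
- by move=> x x' _ ->.
- by move=> x x' y y' _ -> _ ->.
- by move=> c x x' _ ->.
- by move=> x x' y y' _ -> _ ->.
- by move=> *; rewrite addrA.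
- by move=> *; rewrite addrC.
- by move=> *; rewrite add0r.
- by move=> *; rewrite addNr.
- by move=> *; rewrite scalerA.
- by move=> *; rewrite scale1r.
- by move=> *; rewrite scalerDr.
- by move=> *; rewrite scalerDl.
- by move=> *; rewrite namulDl.
- by move=> *; rewrite namulDr.
- by move=> *; rewrite namulZl.
- by move=> *; rewrite namulZr.
- by move=> x y; apply/eqP; rewrite -subr_eq0; apply/eqP/naassoc_xxy.
- by move=> x y; apply/eqP; rewrite -subr_eq0; apply/eqP/naassoc_yxx.
Qed.

Definition is_alg_hom (f : free_alt -> B) : Prop :=
  linear f /\ forall x y, f (x ** y) = f x ** f y.

Lemma free_alt_universal :
  exists! f : free_alt -> B, is_alg_hom f /\ forall i, f (fa_gen i) = g i.
Proof.
pose f (x : free_alt) := term_eval (fa_repr x).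
have fE t : f (fa_class t) = term_eval t by apply: term_eval_eq; apply: fa_repr_class.
exists f; split.
  split; last by move=> i; rewrite fE.
  split=> [c x y|x y]; elim/fa_ind: x => x; elim/fa_ind: y => y.
    by rewrite {1}/GRing.scale {1}/GRing.add /= !faE !fE.
  by rewrite {1}/namul /= !faE !fE.
move=> h [[hlin hM] hg]; apply/funext; elim/fa_ind => t; rewrite fE.
have h0 : h 0 = 0 by rewrite -[X in h X](subrr 0) -scaleN1r addrC hlin scaleN1r addNr.
have hD x y : h (x + y) = h x + h y by rewrite -[x in LHS]scale1r hlin scale1r.
have hZ c x : h (c *: x) = c *: h x by rewrite -[_ *: x]addr0 hlin h0 addr0.
elim: t => [i||x IH|x IHx y IHy|c x IH|x IHx y IHy] /=.
- by rewrite -hg.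
- by rewrite -h0.
- by rewrite IH -fa_oppE -[RHS]/(h (- _)) -[in RHS]scaleN1r hZ scaleN1r.
- by rewrite IHx IHy -hD -fa_addE.
- by rewrite IH -hZ -fa_scaleE.
- by rewrite IHx IHy -hM -fa_mulE.
Qed.

End UniversalProperty.

End FreeAlternative.

Notation "Alt[X]_ F" := (free_alt F nat) (at level 8, F at level 2).

(* Main.v *)
Require Import Defs.
From HB Require Import structures.
From mathcomp Require Import all_boot all_algebra.
From mathcomp Require Import boolp classical_sets.

(** Write x o y = xy + yx and, for a word s = (a_1, ..., a_k), write [x, s] for
    the long commutator [x, a_1, ..., a_k]. In an alternative algebra the maps
    [_, c] and (_, b, c) are derivations of the product o ([jor_comm], [jor_as]).
    Hence u_m(a; s, e) = -(r, a, e) with r = [a^2, s] - a o [a, s]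
    ([useq_rcons]), which is a derivation of o in the last argument e
    ([useq_jor]).

    Suppose that u_m is alternating in its m arguments and vanishes as soon as
    one of them is a commutator. As 2yz = y o z + [y, z], the value u_m(.., yz)
    is then (y o u_m(.., z) + z o u_m(.., y))/2. Hence for every ideal I the
    elements that can be put in a given slot to obtain a value in I form a
    subalgebra ([useq_slot_subalgebra]), so that I contains all values of u_m as
    soon as it contains the values on a generating set ([useq_gen]). The
    generating set X gives the first claim. In an n-generated algebra, take
    I = 0: among n+1 generators two coincide, so u_{n+1} vanishes on them because
    it alternates, hence everywhere.

    It remains to prove, by induction on m, that
    - u_m is alternating ([u_alt]),
    - u_m vanishes when an argument is a commutator ([u_comm0]),
    - [u_m(a; s, b), b] = 0 ([u_last_comm]).
    For m = 1, 2 this holds because u_m = 0.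

    Alternation of u_{m+1} follows from the three properties of u_m. One identity,
    [useq_last], is u_{m+1}(s, b, b) = -[u_m(s, b), b]; another, [useq_cyc],
    expresses 2u_{m+1}(b, s, e) + 2u_{m+1}(s, e, b) through u_m, so that a pair
    of equal neighbours can be rotated around the word ([u_rotn]).

    The two other properties of u_m, for m at least 3, follow from alternation of
    u_m and from the vanishing of u_{m-1} on commutators. Consider the values
    kappa = [u_m(q, j), j] and gamma = u_m(s, j, [j, b]). The identities above
    express in terms of them the values of u_{m+1} on the words jjbs, bjjs, jbjs.
    Independently, u_m(i, j, s) = 3 psi_s((a, i, j)) for a linear map psi_s such
    that psi_s([a, z]) = u_{m-1}(z, s) ([useq_psi], [psi_comm]); this yields a
    further expression of gamma through u_{m+1} ([useq_comm_rep]) and the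
    vanishing of the cyclic sum of u_m([i, j], k, s) ([useq_comm_cyc]). The
    resulting linear relations force gamma = 0, and then kappa = 0, which is the
    third property. Finally u_m(w, e, [j, b]) is skew in e, j, b by gamma = 0, so
    its cyclic sum is three times itself; hence it vanishes, which is the second
    property. *)

Set Implicit Arguments.
Unset Strict Implicit.
Unset Printing Implicit Defensive.

Import GRing.Theory.
Local Open Scope ring_scope.
Local Open Scope na_scope.

(** * Identities of free nonassociative algebras by reflection *)

(** The Jordan product, without the factor 1/2. *)
Definition jor (F : fieldType) (A : naAlgType F) (x y : A) : A := x ** y + y ** x.

(** Nonassociative monomials in variables numbered by natural numbers. *)
Inductive na_tree := TLeaf of nat | TNode of na_tree & na_tree.

Fixpoint tree_eq (t u : na_tree) : bool :=
  match t, u with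
  | TLeaf m, TLeaf n => m == n
  | TNode t1 t2, TNode u1 u2 => tree_eq t1 u1 && tree_eq t2 u2
  | _, _ => false
  end.

Lemma tree_eqP t u : tree_eq t u -> t = u.
Proof.
elim: t u => [m|t1 IH1 t2 IH2] [n|u1 u2] //=; first by move/eqP->.
by case/andP=> /IH1 -> /IH2 ->.
Qed.

(** Syntax of the expressions that are normalised. *)
Inductive na_expr :=
| NVar of nat
| NZero
| NOpp of na_expr
| NAdd of na_expr & na_expr
| NMuln of na_expr & nat
| NMul of na_expr & na_expr
| NComm of na_expr & na_expr
| NJor of na_expr & na_expr
| NAss of na_expr & na_expr & na_expr.

(** Integral combinations of monomials: elements of a free nonassociative ring. *)
Definition na_poly := seq (na_tree * int).

Fixpoint padd1 (t : na_tree) (c : int) (p : na_poly) : na_poly :=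
  match p with
  | [::] => [:: (t, c)]
  | (u, d) :: q => if tree_eq t u then (u, c + d) :: q else (u, d) :: padd1 t c q
  end.
Definition padd (p q : na_poly) : na_poly :=
  foldr (fun tc r => padd1 tc.1 tc.2 r) q p.
Definition pscale (c : int) (p : na_poly) : na_poly := [seq (tc.1, c * tc.2) | tc <- p].
Definition pmul (p q : na_poly) : na_poly :=
  foldr (fun tc r => padd [seq (TNode tc.1 ud.1, tc.2 * ud.2) | ud <- q] r) [::] p.

Fixpoint na_norm (e : na_expr) : na_poly :=
  match e with
  | NVar n => [:: (TLeaf n, 1)]
  | NZero => [::]
  | NOpp x => pscale (-1) (na_norm x)
  | NAdd x y => padd (na_norm x) (na_norm y)
  | NMuln x n => pscale n%:Z (na_norm x)
  | NMul x y => pmul (na_norm x) (na_norm y)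
  | NComm x y => let p := na_norm x in let q := na_norm y in
      padd (pmul p q) (pscale (-1) (pmul q p))
  | NJor x y => let p := na_norm x in let q := na_norm y in
      padd (pmul p q) (pmul q p)
  | NAss x y z => let p := na_norm x in let q := na_norm y in let r := na_norm z in
      padd (pmul (pmul p q) r) (pscale (-1) (pmul p (pmul q r)))
  end.

Section Eval.
Variables (F : fieldType) (A : naAlgType F) (env : seq A).

Lemma namul0l (x : A) : 0 ** x = 0.
Proof. by rewrite -[X in X ** x](scale0r 0) namulZl scale0r. Qed.
Lemma namul0r (x : A) : x ** 0 = 0.
Proof. by rewrite -[X in x ** X](scale0r 0) namulZr scale0r. Qed.

Lemma namulMzl (x y : A) (c : int) : (x *~ c) ** y = (x ** y) *~ c.
Proof. by rewrite -[x *~ c]scaler_int namulZl scaler_int. Qed.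
Lemma namulMzr (x y : A) (c : int) : x ** (y *~ c) = (x ** y) *~ c.
Proof. by rewrite -[y *~ c]scaler_int namulZr scaler_int. Qed.

Fixpoint tree_eval (t : na_tree) : A :=
  match t with
  | TLeaf n => nth 0 env n
  | TNode t1 t2 => tree_eval t1 ** tree_eval t2
  end.

Definition poly_eval (p : na_poly) : A := \sum_(tc <- p) tree_eval tc.1 *~ tc.2.

Fixpoint na_eval (e : na_expr) : A :=
  match e with
  | NVar n => nth 0 env n
  | NZero => 0
  | NOpp x => - na_eval x
  | NAdd x y => na_eval x + na_eval y
  | NMuln x n => na_eval x *+ n
  | NMul x y => na_eval x ** na_eval y
  | NComm x y => nacomm (na_eval x) (na_eval y)
  | NJor x y => jor (na_eval x) (na_eval y)
  | NAss x y z => naassoc (na_eval x) (na_eval y) (na_eval z)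
  end.

Lemma padd1E t c p : poly_eval (padd1 t c p) = tree_eval t *~ c + poly_eval p.
Proof.
rewrite /poly_eval; elim: p => [|[u d] p IH] /=; first by rewrite big_seq1 big_nil addr0.
case: ifP => [/tree_eqP->|_]; rewrite !big_cons /=; last by rewrite IH addrCA.
by rewrite mulrzDr addrA.
Qed.

Lemma paddE p q : poly_eval (padd p q) = poly_eval p + poly_eval q.
Proof.
elim: p => [|[t c] p IH] /=; first by rewrite /poly_eval big_nil add0r.
by rewrite padd1E IH addrA; congr (_ + _); rewrite /poly_eval big_cons.
Qed.

Lemma pscaleE c p : poly_eval (pscale c p) = poly_eval p *~ c.
Proof.
rewrite /poly_eval; elim: p => [|[t d] p IH] /=; first by rewrite !big_nil mul0rz.
by rewrite !big_cons IH /= mulrzDl mulrC mulrzA.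
Qed.

Lemma namul_suml (p : na_poly) (x : A) :
  poly_eval p ** x = \sum_(tc <- p) (tree_eval tc.1 ** x) *~ tc.2.
Proof.
rewrite /poly_eval; elim: p => [|tc p IH]; first by rewrite !big_nil namul0l.
by rewrite !big_cons namulDl IH namulMzl.
Qed.

Lemma pmulE p q : poly_eval (pmul p q) = poly_eval p ** poly_eval q.
Proof.
rewrite namul_suml; elim: p => [|[t c] p IH] /=; first by rewrite /poly_eval !big_nil.
rewrite paddE IH big_cons /=; congr (_ + _); rewrite {IH p}.
rewrite /poly_eval big_map /=; elim: q => [|[u d] q IH]; first by rewrite !big_nil namul0r mul0rz.
by rewrite !big_cons IH namulDr mulrzDl /= namulMzr -mulrzA (mulrC c).
Qed.

Lemma na_normE e : poly_eval (na_norm e) = na_eval e.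
Proof.
elim: e => [n||x IH|x IHx y IHy|x IH n|x IHx y IHy|x IHx y IHy|x IHx y IHy|x IHx y IHy z IHz] /=.
- by rewrite /poly_eval big_seq1.
- by rewrite /poly_eval big_nil.
- by rewrite pscaleE IH mulrN1z.
- by rewrite paddE IHx IHy.
- by rewrite pscaleE IH.
- by rewrite pmulE IHx IHy.
- by rewrite paddE pscaleE !pmulE IHx IHy mulrN1z.
- by rewrite paddE !pmulE IHx IHy.
- by rewrite paddE pscaleE !pmulE IHx IHy IHz mulrN1z.
Qed.

Lemma na_norm0 e : all (fun tc => tc.2 == 0) (na_norm e) -> na_eval e = 0.
Proof.
rewrite -na_normE /poly_eval; elim: (na_norm e) => [|tc p IH] /=; first by rewrite big_nil.
by case/andP=> /eqP tc0 /IH p0; rewrite big_cons p0 tc0 mulr0z addr0.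
Qed.

Lemma na_ring_correct e1 e2 :
  all (fun tc => tc.2 == 0) (na_norm (NAdd e1 (NOpp e2))) -> na_eval e1 = na_eval e2.
Proof. by move/na_norm0 => /= /eqP; rewrite subr_eq0 => /eqP. Qed.

End Eval.

Section NullLaws.
Variables (F : fieldType) (A : naAlgType F).
Implicit Types x y : A.

Lemma nacomm0l x : nacomm 0 x = 0. Proof. by rewrite /nacomm namul0l namul0r subrr. Qed.
Lemma nacomm0r x : nacomm x 0 = 0. Proof. by rewrite /nacomm namul0l namul0r subrr. Qed.
Lemma jor0l x : jor 0 x = 0. Proof. by rewrite /jor namul0l namul0r addr0. Qed.
Lemma jor0r x : jor x 0 = 0. Proof. by rewrite /jor namul0l namul0r addr0. Qed.
Lemma naassoc0l x y : naassoc 0 x y = 0.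
Proof. by rewrite /naassoc !namul0l subrr. Qed.
Lemma naassoc0m x y : naassoc x 0 y = 0.
Proof. by rewrite /naassoc namul0r !namul0l namul0r subrr. Qed.
Lemma naassoc0r x y : naassoc x y 0 = 0.
Proof. by rewrite /naassoc !namul0r subrr. Qed.
End NullLaws.
Definition na0E := (nacomm0l, nacomm0r, jor0l, jor0r, naassoc0l, naassoc0m, naassoc0r).

(** The difference of the two sides of an equation H. *)
Definition dif (V : zmodType) (x y : V) (H : x = y) : V := x - y.
Lemma dif0 (V : zmodType) (x y : V) (H : x = y) : dif H = 0.
Proof. by rewrite /dif H subrr. Qed.

Ltac na_same x y := first [constr_eq x y | unify x y].
Ltac na_mem x l :=
  match l with
  | nil => constr:(false)
  | cons ?y ?l' =>
      match goal with
      | _ => let _ := match goal with _ => na_same x y end in constr:(true)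
      | _ => na_mem x l'
      end
  end.
Ltac na_atoms l t :=
  lazymatch t with
  | GRing.add ?x ?y => let l := na_atoms l x in na_atoms l y
  | GRing.opp ?x => na_atoms l x
  | GRing.natmul ?x _ => na_atoms l x
  | GRing.zero => l
  | namul ?x ?y => let l := na_atoms l x in na_atoms l y
  | nacomm ?x ?y => let l := na_atoms l x in na_atoms l y
  | jor ?x ?y => let l := na_atoms l x in na_atoms l y
  | naassoc ?x ?y ?z => let l := na_atoms l x in let l := na_atoms l y in na_atoms l z
  | @dif _ ?x ?y _ => let l := na_atoms l x in na_atoms l y
  | _ => match na_mem t l with
         | true => l
         | false => constr:(cons t l)
         end
  end.
Ltac na_index x l :=
  match l with
  | cons ?y ?l' =>
      match goal with
      | _ => let _ := match goal with _ => na_same x y end in constr:(O)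
      | _ => let n := na_index x l' in constr:(S n)
      end
  end.
Ltac na_reify l t :=
  lazymatch t with
  | GRing.add ?x ?y => let a := na_reify l x in let b := na_reify l y in constr:(NAdd a b)
  | GRing.opp ?x => let a := na_reify l x in constr:(NOpp a)
  | GRing.natmul ?x ?n => let a := na_reify l x in constr:(NMuln a n)
  | GRing.zero => constr:(NZero)
  | namul ?x ?y => let a := na_reify l x in let b := na_reify l y in constr:(NMul a b)
  | nacomm ?x ?y => let a := na_reify l x in let b := na_reify l y in constr:(NComm a b)
  | jor ?x ?y => let a := na_reify l x in let b := na_reify l y in constr:(NJor a b)
  | naassoc ?x ?y ?z =>
      let a := na_reify l x in let b := na_reify l y in let c := na_reify l z in
      constr:(NAss a b c)
  | @dif _ ?x ?y _ => let a := na_reify l x in let b := na_reify l y in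
      constr:(NAdd a (NOpp b))
  | _ => let n := na_index t l in constr:(NVar n)
  end.

(** Proves an equation valid in every nonassociative algebra. Every [dif H] stands
    for the difference of the two sides of H, and its maximal subterms that are not sums, multiples, products,
    commutators or associators stand for variables. *)
Ltac na_ring :=
  lazymatch goal with
  | |- @eq ?T ?lhs ?rhs =>
    let l := na_atoms (@nil T) lhs in
    let l := na_atoms l rhs in
    let e1 := na_reify l lhs in
    let e2 := na_reify l rhs in
    refine (@na_ring_correct _ _ l e1 e2 _); vm_compute; reflexivity
  end.

(** Proves an equation whose sides differ by t, up to the laws of nonassociative
    algebras, where t is a combination of differences [dif H]. *)
Ltac na_comb t :=
  lazymatch goal with
  | |- @eq ?T ?lhs ?rhs =>
    let K := fresh in
    have K : lhs - rhs = t; [na_ring |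
      apply/eqP; rewrite -subr_eq0 K !dif0
        ?(na0E, namul0l, namul0r, mul0rn, oppr0, addr0, subr0, add0r); exact: eqxx]
  end.

(** * Identities of alternative algebras *)

Section AlternativeIdentities.
Variables (F : fieldType) (A : altAlgType F).
Implicit Types x y z t a b c d e w i j k : A.

Lemma as12 x y z : naassoc x y z = - naassoc y x z.
Proof.
na_comb (dif (naassoc_xxy (x + y) z) - dif (naassoc_xxy x z) - dif (naassoc_xxy y z)).
Qed.

Lemma as23 x y z : naassoc x y z = - naassoc x z y.
Proof.
na_comb (dif (naassoc_yxx (y + z) x) - dif (naassoc_yxx y x) - dif (naassoc_yxx z x)).
Qed.

Lemma as_rot x y z : naassoc x y z = naassoc y z x.
Proof. by rewrite as12 as23 opprK. Qed.

Lemma as_xyx x y : naassoc x y x = 0.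
Proof. by rewrite as23 naassoc_xxy oppr0. Qed.

(** The Kleinfeld function. It is skew-symmetric in its four arguments, as the
    lemmas [kl12], [kl23] and [kl34] on adjacent transpositions express. *)
Local Notation kl x y z t :=
  (naassoc (x ** y) z t - y ** naassoc x z t - naassoc y z t ** x).

Lemma kl34 x y z t : kl x y z t = - kl x y t z.
Proof. by rewrite (as23 (x ** y)) (as23 x) (as23 y); na_ring. Qed.

Lemma kl_cyc x y z t : kl x y z t = - kl t x y z.
Proof.
na_comb (dif (as_rot x (y ** z) t) - dif (as_rot x y (z ** t))
  + dif (as_rot (t ** x) y z) - x ** dif (as_rot t y z) - y ** dif (as_rot x z t)).
Qed.

Lemma kl23 x y z t : kl x y z t = - kl x z y t.
Proof. by rewrite kl_cyc kl34 (kl_cyc x z) !opprK. Qed.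

Lemma kl12 x y z t : kl x y z t = - kl y x z t.
Proof. by rewrite kl_cyc kl_cyc kl34 (kl_cyc y) (kl_cyc t) !opprK. Qed.

(** The maps [_, c] and (_, b, c) are derivations of the Jordan product. *)
Lemma jor_comm x y c : nacomm (jor x y) c = jor x (nacomm y c) + jor (nacomm x c) y.
Proof.
na_comb (dif (as12 x y c) *+ 2 - dif (as23 x c y) - dif (as23 y c x)
  + dif (as23 c x y)).
Qed.

Lemma jor_as x y z t :
  naassoc (jor x y) z t = jor x (naassoc y z t) + jor (naassoc x z t) y.
Proof. na_comb (dif (kl12 x y z t)). Qed.

(** The identity (xy, z, t) - (x, yz, t) + (x, y, zt) = x(y, z, t) + (x, y, z)t,
    valid in every algebra, rewritten through the cyclic symmetry of the Kleinfeld
    function. *)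
Lemma kl3 x y z t : kl x y z t *+ 3 =
  nacomm x (naassoc y z t) - nacomm y (naassoc x z t)
  + nacomm z (naassoc t x y) - nacomm t (naassoc z x y).
Proof.
na_comb (dif (kl_cyc y z t x) *+ 2 - dif (kl_cyc z t x y)
  + dif (as_rot x (y ** z) t) - dif (as_rot x y (z ** t)) - dif (as_rot y (z ** t) x)
  - dif (as_rot x z t) ** y + z ** dif (as_rot y t x) - dif (as_rot z x y) ** t).
Qed.

Lemma kl_comm x y z t :
  kl x y z t = naassoc (nacomm x y) z t + naassoc (nacomm z t) x y.
Proof.
na_comb (dif (kl12 x y z t) + dif (kl12 z t x y) - dif (kl3 x y z t)
  + dif (kl_cyc y z t x) *+ 2 - dif (kl_cyc z t x y) *+ 2).
Qed.

Lemma as_comm2 x y z t :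
  naassoc (nacomm z t) x y + naassoc (nacomm x y) z t *+ 2 =
  nacomm z (naassoc t x y) - nacomm t (naassoc z x y).
Proof.
na_comb (dif (kl3 x y z t) - dif (kl12 x y z t) - dif (kl_comm x y z t)).
Qed.

(** The skew-symmetry of the Kleinfeld function in its middle arguments, on the
    form given by [kl_comm]. *)
Lemma as_comm_skew x y z t :
  naassoc (nacomm x y) z t + naassoc (nacomm z t) x y =
  - (naassoc (nacomm x z) y t + naassoc (nacomm y t) x z).
Proof. by rewrite -!kl_comm kl23. Qed.

Lemma comm_comm x b c :
  nacomm (nacomm x b) c - nacomm (nacomm x c) b =
  nacomm x (nacomm b c) + naassoc x b c *+ 6.
Proof.
na_comb (dif (as12 x c b) - dif (as12 x b c) *+ 3 - dif (as23 x b c) *+ 2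
  + dif (as23 b x c) *+ 2 - dif (as12 b c x)).
Qed.

Lemma as_comm_rep x y b : naassoc (nacomm x b) y b = - nacomm (naassoc x y b) b.
Proof.
have k0 : kl x y b b = 0.
  na_comb (dif (naassoc_yxx b (x ** y)) - y ** dif (naassoc_yxx b x)
    - dif (naassoc_yxx b y) ** x).
na_comb (dif (kl23 x b y b) *+ 2 - dif k0 *+ 2 - dif (kl12 b x y b)
  + dif (as_xyx b y) ** x - x ** dif (as_xyx b y)).
Qed.

Hypothesis charF0 : [pchar F] =i pred0.

Lemma mulrnI0 x n : x *+ n.+1 = 0 -> x = 0.
Proof.
move/eqP; rewrite -scaler_nat scaler_eq0.
by move/pcharf0P: charF0 => ->; move/eqP.
Qed.

(** For fixed a the commutator with a anticommutes with each map (a, b, _);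
    comparing the two compositions on a square gives the identity. *)
Lemma jor_comm_as_rep a b j : jor (nacomm a j) (naassoc a b j) = 0.
Proof.
have anti z : naassoc a b (nacomm z a) = - nacomm (naassoc a b z) a.
  na_comb (dif (as_rot a b (nacomm z a)) + dif (as12 b (nacomm z a) a)
    + nacomm (dif (as_rot a b z) + dif (as12 b z a)) a - dif (as_comm_rep z b a)).
have jj z w : naassoc a b (jor z w) = jor z (naassoc a b w) + jor (naassoc a b z) w.
  by rewrite -!(as_rot _ a b) jor_as.
apply: (@mulrnI0 _ 3).
na_comb (naassoc a b (dif (jor_comm j j a)) - dif (anti (jor j j))
 + dif (jj j (nacomm j a)) *+ 2 + nacomm (dif (jj j j)) a + jor j (dif (anti j)) *+ 2
 + dif (jor_comm j (naassoc a b j) a) *+ 2).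
Qed.

(** Linearisation of the preceding identity in j. *)
Lemma jor_comm_as_swap a b j k :
  jor (nacomm a j) (naassoc a b k) = - jor (nacomm a k) (naassoc a b j).
Proof.
na_comb (dif (jor_comm_as_rep a b (j + k)) - dif (jor_comm_as_rep a b j)
  - dif (jor_comm_as_rep a b k)).
Qed.

Lemma as_jor_comm a b e w :
  naassoc (jor (nacomm a b) w) a e = nacomm a (jor w (naassoc a b e)).
Proof.
na_comb (dif (jor_as (nacomm a b) w a e) + dif (jor_comm w (naassoc a b e) a)
  + jor w (dif (as_comm_rep b e a) - dif (as23 (nacomm b a) a e)
           + nacomm (dif (as_rot a b e)) a)
  + dif (jor_comm_as_swap a e b w) + jor (nacomm a b) (dif (as_rot w a e))
  + jor (nacomm w a) (dif (as23 a b e))).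
Qed.

Lemma as_comm_cyc a i j k :
  naassoc a k (nacomm i j) + naassoc a i (nacomm j k) + naassoc a j (nacomm k i)
  = nacomm a (naassoc i j k) *+ 2.
Proof.
apply/eqP; rewrite -subr_eq0; apply/eqP; apply: (@mulrnI0 _ 2).
na_comb (dif (as_rot a k (nacomm i j)) *+ 3 + dif (as_rot k (nacomm i j) a) *+ 3
  + dif (as_rot a i (nacomm j k)) *+ 3 + dif (as_rot i (nacomm j k) a) *+ 3
  + dif (as_rot a j (nacomm k i)) *+ 3 + dif (as_rot j (nacomm k i) a) *+ 3
  - dif (as_comm2 a k i j) + dif (as_comm2 i j a k) *+ 2
  - dif (as_comm2 a i j k) + dif (as_comm2 j k a i) *+ 2
  - dif (as_comm2 a j k i) + dif (as_comm2 k i a j) *+ 2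
  + nacomm a (dif (as_rot k i j) - dif (as_rot i j k)) *+ 2
  + nacomm k (dif (as_rot i a j) + dif (as12 a j i) - dif (as12 a i j) *+ 2)
  + nacomm i (dif (as_rot j a k) + dif (as12 a k j) - dif (as12 a j k) *+ 2)
  + nacomm j (dif (as_rot k a i) + dif (as12 a i k) - dif (as12 a k i) *+ 2)).
Qed.

Lemma as_jacobi x y z : naassoc x y z *+ 6 =
  nacomm (nacomm x y) z + nacomm (nacomm y z) x + nacomm (nacomm z x) y.
Proof.
na_comb (dif (as12 x y z) *+ 3 + dif (as23 x y z) *+ 2 - dif (as12 x z y)
  - dif (as23 y x z) *+ 2 + dif (as12 y z x)).
Qed.

Lemma as_sqr x y z : naassoc (x ** x) y z = jor x (naassoc x y z).
Proof.
apply/eqP; rewrite -subr_eq0; apply/eqP; apply: (@mulrnI0 _ 1).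
na_comb (dif (jor_as x x y z)).
Qed.

Lemma comm_sqr x c : nacomm (x ** x) c = jor x (nacomm x c).
Proof.
apply/eqP; rewrite -subr_eq0; apply/eqP; apply: (@mulrnI0 _ 1).
na_comb (dif (jor_comm x x c)).
Qed.

(** For y = [a, s] and p = [a^2, s] the left-hand side is u(a; s, e). *)
Lemma as_defect a y p e :
  naassoc y (a ** a) e - naassoc p a e = - naassoc (p - jor a y) a e.
Proof.
na_comb (dif (as12 y (a ** a) e) - dif (as_sqr a y e) - jor a (dif (as12 a y e))
  - dif (jor_as a y a e) - jor (dif (naassoc_xxy a e)) y).
Qed.

(** The algebraic content of moving the first letter b of a word to its end. Here
    bb = [a, b] is the first step of the commutator word in a, and r, y, q, z, v
    are to be [a^2, s] - a o [a, s], [a, s], [a o bb, s], [bb, s], [bb^2, s]; the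
    values at a + bb, a - bb and bb together isolate the part of degree one in bb. *)
Lemma as_cyc a b e r y q z v :
  let bb := nacomm a b in
  (naassoc (q - jor a z) a e + naassoc (nacomm (r + jor a y) e - jor a (nacomm y e)) a b) *+ 2 =
  (naassoc (r + jor a y + q + v - jor (a + bb) (y + z)) (a + bb) e
   - naassoc (r + jor a y - q + v - jor (a - bb) (y - z)) (a - bb) e
   - naassoc (v - jor bb z) bb e *+ 2)
  - (naassoc r a (nacomm e b) + nacomm (naassoc r a e) b - nacomm (naassoc r a b) e).
Proof.
move=> bb; rewrite /bb {bb}.
na_comb (naassoc (dif (jor_comm a y e)) a b *+ 2
  + dif (as_jor_comm a b e y) *+ 2 + dif (as_jor_comm a e b y) *+ 2
  + nacomm a (jor y (dif (as23 a b e))) *+ 2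
  - dif (as12 r (nacomm a b) e) *+ 2 + dif (as_comm_skew r e a b) *+ 2
  - dif (as_comm2 r a e b) - dif (as_rot (nacomm e b) r a)
  - nacomm e (dif (as_rot b r a)) + nacomm b (dif (as_rot e r a))).
Qed.

End AlternativeIdentities.

(** * Multilinear and alternating functions of sequences *)

(** The sign -1 raised to the power b, applied to x. *)
Definition sgo (V : zmodType) (b : bool) (x : V) : V := if b then - x else x.

Lemma sgo0 (V : zmodType) b : sgo b (0 : V) = 0.
Proof. by case: b; rewrite /= ?oppr0. Qed.
Lemma sgo_eq0 (V : zmodType) b (x : V) : sgo b x = 0 -> x = 0.
Proof. by case: b => //= /eqP; rewrite oppr_eq0 => /eqP. Qed.

Section Alternating.
Variables (F : fieldType) (V : lmodType F) (f : seq V -> V).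
Hypothesis fD : forall p x y q, f (p ++ (x + y) :: q) = f (p ++ x :: q) + f (p ++ y :: q).

(** f vanishes on the words of length n with two equal neighbours. *)
Definition alternating_at (n : nat) :=
  forall p c q, (size p + size q).+2 = n -> f (p ++ c :: c :: q) = 0.

Variable n : nat.
Hypothesis falt : alternating_at n.

Lemma alt_swap p c d q : (size p + size q).+2 = n ->
  f (p ++ c :: d :: q) = - f (p ++ d :: c :: q).
Proof.
move=> sz; have := falt (c + d) sz; rewrite fD.
have E x : f (p ++ x :: (c + d) :: q) = f (p ++ x :: c :: q) + f (p ++ x :: d :: q).
  by rewrite -!(cat_rcons x) fD.
by rewrite !E !falt // add0r addr0 => /eqP; rewrite addr_eq0 => /eqP.
Qed.

Lemma alt_move p c q r : (size p + size q + size r).+1 = n ->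
  f (p ++ c :: q ++ r) = sgo (odd (size q)) (f (p ++ q ++ c :: r)).
Proof.
elim: q p => [|d q IH] p sz //=.
rewrite (@alt_swap p c d); last by rewrite size_cat -sz /= addnS addSn addnA.
rewrite -(cat_rcons d p (c :: _)) IH; last by rewrite size_rcons -sz /= addnS !addSn.
by rewrite cat_rcons /sgo; case: (odd _); rewrite //= opprK.
Qed.

Lemma alt_rep p c q r : (size p + size q + size r).+2 = n ->
  f (p ++ c :: q ++ c :: r) = 0.
Proof.
move=> sz; rewrite alt_move; last by rewrite /= addnS.
by rewrite catA falt ?size_cat // sgo0.
Qed.

End Alternating.

(** * The elements u_n as functions of words *)

Section Words.
Variables (F : fieldType) (A : naAlgType F).
Implicit Types (a b c x y w : A) (p q s t : seq A).

Lemma nacommDl x y c : nacomm (x + y) c = nacomm x c + nacomm y c.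
Proof. na_ring. Qed.
Lemma nacommDr c x y : nacomm c (x + y) = nacomm c x + nacomm c y.
Proof. na_ring. Qed.
Lemma nacommZl (k : F) x c : nacomm (k *: x) c = k *: nacomm x c.
Proof. by rewrite /nacomm namulZl namulZr scalerBr. Qed.
Lemma nacommZr (k : F) c x : nacomm c (k *: x) = k *: nacomm c x.
Proof. by rewrite /nacomm namulZl namulZr scalerBr. Qed.

Lemma lcD x y s : long_comm (x + y) s = long_comm x s + long_comm y s.
Proof. by elim: s x y => //= c s IH x y; rewrite nacommDl IH. Qed.
Lemma lcZ (k : F) x s : long_comm (k *: x) s = k *: long_comm x s.
Proof. by elim: s x => //= c s IH x; rewrite nacommZl IH. Qed.
Lemma lcN x s : long_comm (- x) s = - long_comm x s.
Proof. by rewrite -scaleN1r lcZ scaleN1r. Qed.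
Lemma lc0 s : long_comm (0 : A) s = 0.
Proof. by rewrite -[X in long_comm X](scale0r (0 : A)) lcZ scale0r. Qed.
Lemma lc_cat x s t : long_comm x (s ++ t) = long_comm (long_comm x s) t.
Proof. exact: foldl_cat. Qed.
Lemma lc_rcons x s c : long_comm x (rcons s c) = nacomm (long_comm x s) c.
Proof. exact: foldl_rcons. Qed.

Lemma lc_slotD w p x y q :
  long_comm w (p ++ (x + y) :: q) = long_comm w (p ++ x :: q) + long_comm w (p ++ y :: q).
Proof. by rewrite !lc_cat /= nacommDr lcD. Qed.
Lemma lc_slotZ w p (k : F) x q :
  long_comm w (p ++ (k *: x) :: q) = k *: long_comm w (p ++ x :: q).
Proof. by rewrite !lc_cat /= nacommZr lcZ. Qed.

(** The element u_n(a; t) where the word t determines n, its length. *)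
Definition useq a t : A :=
  naassoc (long_comm a (take (size t).-1 t)) (a ** a) (last 0 t)
  - naassoc (long_comm (a ** a) (take (size t).-1 t)) a (last 0 t).

Lemma u_eltE n a (t : n.-tuple A) : u_elt a t = useq a t.
Proof. by rewrite /useq size_tuple. Qed.

(** The element r with u(a; s, e) = -(r, a, e). It vanishes for a word of length
    one, since [_, c] is a derivation of the Jordan product. *)
Definition defect a s : A := long_comm (a ** a) s - jor a (long_comm a s).

End Words.

Section UElements.
Variables (F : fieldType) (charF0 : [pchar F] =i pred0) (A : altAlgType F).
Implicit Types (a b c e j x y w : A) (p q s t : seq A).

Lemma useq_rcons a s e : useq a (rcons s e) = - naassoc (defect a s) a e.
Proof.
rewrite /useq size_rcons /= -cats1 take_size_cat // last_cat /=.
by rewrite as_defect.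
Qed.

Lemma defect_slotD a p x y q :
  defect a (p ++ (x + y) :: q) = defect a (p ++ x :: q) + defect a (p ++ y :: q).
Proof. by rewrite /defect !lc_slotD; na_ring. Qed.

Lemma useqD a p x y q :
  useq a (p ++ (x + y) :: q) = useq a (p ++ x :: q) + useq a (p ++ y :: q).
Proof.
case/lastP: q => [|q e]; rewrite ?cats1 -?rcons_cons -?rcons_cat !useq_rcons; first by na_ring.
by rewrite defect_slotD; na_ring.
Qed.

Lemma useqZ a p (k : F) x q : useq a (p ++ (k *: x) :: q) = k *: useq a (p ++ x :: q).
Proof.
have asZ1 z1 z2 z3 : naassoc (k *: z1) z2 z3 = k *: naassoc z1 z2 z3 :> A.
  by rewrite /naassoc !namulZl scalerBr.
have asZ3 z1 z2 z3 : naassoc z1 z2 (k *: z3) = k *: naassoc z1 z2 z3 :> A.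
  by rewrite /naassoc !namulZr scalerBr.
case/lastP: q => [|q e]; rewrite ?cats1 -?rcons_cons -?rcons_cat !useq_rcons.
  by rewrite asZ3 scalerN.
have -> : defect a (p ++ (k *: x) :: q) = k *: defect a (p ++ x :: q).
  by rewrite /defect !lc_slotZ /jor namulZl namulZr scalerBr scalerDr.
by rewrite asZ1 scalerN.
Qed.

Lemma useq_slotN a p x q : useq a (p ++ (- x) :: q) = - useq a (p ++ x :: q).
Proof. by rewrite -scaleN1r useqZ scaleN1r. Qed.

(** The right-hand side involves u only on words shorter by one letter. *)
Lemma useq_cyc a b s e :
  useq a (b :: rcons s e) *+ 2 + useq a (rcons (rcons s e) b) *+ 2 =
  (useq (a + nacomm a b) (rcons s e) - useq (a - nacomm a b) (rcons s e)
   - useq (nacomm a b) (rcons s e) *+ 2)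
  - (useq a (rcons s (nacomm e b)) + nacomm (useq a (rcons s e)) b
     - nacomm (useq a (rcons s b)) e).
Proof.
rewrite -rcons_cons !useq_rcons /defect lc_rcons lc_rcons /= comm_sqr //.
set bb := nacomm a b.
have sq1 : (a + bb) ** (a + bb) = a ** a + jor a bb + bb ** bb by na_ring.
have sq2 : (a - bb) ** (a - bb) = a ** a - jor a bb + bb ** bb by na_ring.
rewrite sq1 sq2 !(lcD (a ** a + _)) !(lcD (a ** a)) (lcD a bb) (lcD a (- bb)) !lcN.
set P := long_comm (a ** a) s; set y := long_comm a s; set q := long_comm (jor a bb) s.
set z := long_comm bb s; set v := long_comm (bb ** bb) s.
have := as_cyc charF0 a b e (P - jor a y) y q z v; rewrite -/bb /= subrK => cyc.
na_comb (- dif cyc).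
Qed.

Lemma useq_last a s b : useq a (s ++ [:: b; b]) = - nacomm (useq a (rcons s b)) b.
Proof.
rewrite -cat_rcons cats1 !useq_rcons /defect !lc_rcons.
set P := long_comm (a ** a) s; set y := long_comm a s.
na_comb (- naassoc (dif (jor_comm a y b)) a b - dif (as_jor_comm charF0 a b b y)
  - dif (as_comm_rep (P - jor a y) a b) - nacomm a (jor y (dif (naassoc_yxx b a)))).
Qed.

(** * The inductive properties, and alternation of u_{m+1} *)

(** u_n is alternating in its n arguments. *)
Definition u_alt (n : nat) := forall a, alternating_at (useq a) n.
(** u_n vanishes as soon as one of its arguments is a commutator. *)
Definition u_comm0 (n : nat) :=
  forall a p b c q, (size p + size q).+1 = n -> useq a (p ++ nacomm b c :: q) = 0.
(** The last argument of u_n commutes with the value. *)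
Definition u_last_comm (n : nat) :=
  forall a s b, (size s).+1 = n -> nacomm (useq a (rcons s b)) b = 0.

Section Step.
Variable m : nat.
Hypothesis Sm : u_alt m.

(** The right-hand side of [useq_cyc] consists here of values of u_m on words with
    two equal neighbours. *)
Lemma u_rot a x al j be : be != [::] -> (size al + size be).+2 = m ->
  useq a (x :: al ++ j :: j :: be) = - useq a (al ++ j :: j :: be ++ [:: x]).
Proof.
case/lastP: be => // be e _; rewrite size_rcons => sz.
have E : al ++ j :: j :: rcons be e = rcons (al ++ j :: j :: be) e.
  by rewrite -!rcons_cons rcons_cat.
have := useq_cyc a x (al ++ j :: j :: be) e.
have Z b w : useq b (rcons (al ++ j :: j :: be) w) = 0.
  by rewrite rcons_cat (Sm b) // size_rcons.
rewrite !Z E => cyc; apply/eqP; rewrite -subr_eq0; apply/eqP.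
apply: (mulrnI0 charF0 (n := 1)).
have -> : al ++ j :: j :: rcons be e ++ [:: x] = rcons (rcons (al ++ j :: j :: be) e) x.
  by rewrite cats1 !rcons_cat.
na_comb (dif cyc).
Qed.

Lemma u_rotn a g j be : be != [::] -> (size g + size be).+1 = m ->
  useq a (g ++ j :: j :: be) = sgo (odd (size g)) (useq a (j :: j :: be ++ g)).
Proof.
elim: g be => [|x g IH] be bn0 sz; first by rewrite cats0.
rewrite cat_cons u_rot //.
rewrite IH; [|by case: (be)|by rewrite size_cat addn1 addnS -sz].
by rewrite -catA /= /sgo; case: (odd _); rewrite //= opprK.
Qed.

(** This is [useq_cyc] followed by [useq_last]. *)
Lemma u_mid a s j b : (size s).+2 = m ->
  useq a (s ++ [:: j; j; b]) *+ 2 =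
  nacomm (useq a (b :: s ++ [:: j])) j *+ 2 - useq a (s ++ [:: j; nacomm j b])
  + nacomm (useq a (s ++ [:: j; b])) j.
Proof.
move=> sz; have := useq_cyc a b (rcons s j) j.
have Z w : useq w (rcons (rcons s j) j) = 0.
  by rewrite -!cats1 -catA (Sm w) //= addn0.
rewrite !Z => cyc; have := useq_last a (b :: s) j.
rewrite -[rcons (b :: s) j]cats1 /= => last.
have E1 : b :: rcons (rcons s j) j = b :: s ++ [:: j; j] by rewrite -!cats1 -catA.
have E2 w : rcons (rcons s j) w = s ++ [:: j; w] by rewrite -!cats1 -catA.
have E3 : rcons (rcons (rcons s j) j) b = s ++ [:: j; j; b] by rewrite -!cats1 -!catA.
rewrite E1 E3 !E2 in cyc.
na_comb (dif cyc - dif last *+ 2).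
Qed.

Lemma u_alt_step : u_comm0 m -> u_last_comm m -> u_alt m.+1.
Proof.
move=> Nm Lm a.
have mid s j b : (size s).+2 = m -> useq a (s ++ [:: j; j; b]) = 0.
  move=> sz; apply: (mulrnI0 charF0 (n := 1)); rewrite u_mid //.
  rewrite -cat_cons cats1 Lm /=; last by rewrite sz.
  rewrite -(cat_rcons j s [:: nacomm j b]) Nm ?size_rcons ?addn0 //.
  have sw : useq a (s ++ [:: j; b]) = - useq a (s ++ [:: b; j]).
    by rewrite (alt_swap (useqD a) (Sm a)) //= addn0.
  have := Lm a (rcons s b) j; rewrite -[rcons (rcons s b) j]cats1 cat_rcons size_rcons sw => /(_ sz) L.
  na_comb (- dif L).
move=> p j q; case: q => [|b q] sz.
  by rewrite useq_last Lm ?oppr0 //; move: sz; rewrite addn0; case.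
have sz' : (size (q ++ p)).+2 = m by case: sz => /= <-; rewrite size_cat addnS addnC.
rewrite u_rotn //=; last by case: sz.
suff -> : useq a [:: j, j, b & q ++ p] = 0 by rewrite sgo0.
apply: (@sgo_eq0 _ (odd (size (q ++ p)))).
by rewrite -(@u_rotn a (q ++ p) j [:: b]) ?mid //= addn1.
Qed.

End Step.

End UElements.

(** * The linear maps psi *)

Section Psi.
Variables (F : fieldType) (charF0 : [pchar F] =i pred0) (A : altAlgType F).
Implicit Types (a b c e i j k x y w : A) (p q s t : seq A).

(** The element u_n with a and a^2 replaced, under the long commutators only, by
    y and z. *)
Definition useq2 a s y z : A :=
  naassoc (long_comm y (take (size s).-1 s)) (a ** a) (last 0 s)
  - naassoc (long_comm z (take (size s).-1 s)) a (last 0 s).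

(** Since [a^2, z] = a o [a, z], this is the linear map whose value at [a, z] is
    u(a; z, s), for a nonempty word s. *)
Definition psi a s y := useq2 a s y (jor a y).

Lemma useq2D a s y z y' z' :
  useq2 a s (y + y') (z + z') = useq2 a s y z + useq2 a s y' z'.
Proof. by rewrite /useq2 !lcD; na_ring. Qed.
Lemma useq2N a s y z : useq2 a s (- y) (- z) = - useq2 a s y z.
Proof. by rewrite /useq2 !lcN; na_ring. Qed.
Lemma useq2B a s y z y' z' :
  useq2 a s (y - y') (z - z') = useq2 a s y z - useq2 a s y' z'.
Proof. by rewrite useq2D useq2N. Qed.
Lemma useq2_0 a s : useq2 a s 0 0 = 0.
Proof. by rewrite /useq2 !lc0; na_ring. Qed.
Lemma useq2Mn a s y z n : useq2 a s (y *+ n) (z *+ n) = useq2 a s y z *+ n.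
Proof. by elim: n => [|n IH]; rewrite ?useq2_0 // !mulrS useq2D IH. Qed.

Lemma psiD a s y z : psi a s (y + z) = psi a s y + psi a s z.
Proof. by rewrite /psi -useq2D; congr useq2; na_ring. Qed.
Lemma psiN a s y : psi a s (- y) = - psi a s y.
Proof. by rewrite /psi -useq2N; congr useq2; na_ring. Qed.
Lemma psiMn a s y n : psi a s (y *+ n) = psi a s y *+ n.
Proof. by elim: n => [|n IH]; rewrite ?mulr0n ?mulrS ?psiD ?IH // /psi jor0r useq2_0. Qed.

Lemma useq_cons a w s : s != [::] -> useq a (w :: s) = useq2 a s (nacomm a w) (nacomm (a ** a) w).
Proof. by case: s => // c s _. Qed.

Lemma useq_cons2 a i j s : s != [::] ->
  useq a (i :: j :: s) = useq2 a s (nacomm (nacomm a i) j) (nacomm (nacomm (a ** a) i) j).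
Proof. by case: s => // c s _. Qed.

Lemma useq_cons3 a i j k s : s != [::] ->
  useq a (i :: j :: k :: s) =
  useq2 a s (nacomm (nacomm (nacomm a i) j) k) (nacomm (nacomm (nacomm (a ** a) i) j) k).
Proof. by case: s => // c s _. Qed.

Lemma psi_comm a w s : s != [::] -> psi a s (nacomm a w) = useq a (w :: s).
Proof. by move=> s0; rewrite useq_cons // comm_sqr. Qed.

(** This is [comm_comm] on a and on a^2. *)
Lemma useq_inner a i j s : s != [::] ->
  useq a (i :: j :: s) - useq a (j :: i :: s) =
  useq a (nacomm i j :: s) + psi a s (naassoc a i j) *+ 6.
Proof.
move=> s0; rewrite !useq_cons2 // -useq2B !comm_comm useq2D as_sqr //.
by rewrite useq2Mn useq_cons.
Qed.

(** The commutator of (a^2, b, j) = a o (a, b, j) with j has no cross term, because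
    [a, j] o (a, b, j) = 0. *)
Lemma useq_inner_rep a b j s : s != [::] ->
  useq a (b :: j :: j :: s) - useq a (j :: b :: j :: s) =
  useq a (nacomm b j :: j :: s) + psi a s (nacomm (naassoc a b j) j) *+ 6.
Proof.
move=> s0; rewrite !useq_cons3 // useq_cons2 // -useq2B -psiMn /psi -useq2D.
congr useq2.
  na_comb (nacomm (dif (comm_comm a b j)) j).
na_comb (nacomm (dif (comm_comm (a ** a) b j) + dif (as_sqr charF0 a b j) *+ 6) j
  + dif (jor_comm a (naassoc a b j) j) *+ 6 + dif (jor_comm_as_rep charF0 a b j) *+ 6).
Qed.

Variable m : nat.
Hypothesis Sm : @u_alt F A m.
Hypothesis Nm : @u_comm0 F A m.-1.

(** Both sides of [useq_inner] simplify, since u_m alternates and u_{m-1} kills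
    the commutator [i, j]. *)
Lemma useq_psi a i j s : s != [::] -> (size s).+2 = m ->
  useq a (i :: j :: s) = psi a s (naassoc a i j) *+ 3.
Proof.
move=> s0 sz; have := useq_inner a i j s0.
have := @Nm a [::] i j s; rewrite -sz /= add0n => -> //.
have := @alt_swap _ _ _ (useqD charF0 a) _ (Sm a) [::] j i s; rewrite -sz /= => -> // E.
apply/eqP; rewrite -subr_eq0; apply/eqP; apply: (mulrnI0 charF0 (n := 1)).
na_comb (dif E).
Qed.

Lemma useq_comm_rep a b j s : s != [::] -> (size s).+2 = m ->
  useq a (nacomm b j :: j :: s) = useq a (j :: b :: j :: s) - useq a (b :: j :: j :: s).
Proof.
move=> s0 sz; have E := useq_inner_rep a b j s0; have := useq_psi a (nacomm b j) j s0 sz.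
have -> : naassoc a (nacomm b j) j = - nacomm (naassoc a b j) j.
  na_comb (dif (as12 a (nacomm b j) j) - dif (as_comm_rep b a j)
    + nacomm (dif (as12 a b j)) j).
rewrite psiN => P.
na_comb (dif E + dif P *+ 2).
Qed.

Lemma useq_comm_cyc a i j k s : s != [::] -> (size s).+2 = m ->
  useq a (nacomm i j :: k :: s) + useq a (nacomm j k :: i :: s)
  + useq a (nacomm k i :: j :: s) = 0.
Proof.
move=> s0 sz; rewrite !useq_psi // -!mulrnDl -!psiD.
have -> : naassoc a (nacomm i j) k + naassoc a (nacomm j k) i + naassoc a (nacomm k i) j
        = nacomm a (- naassoc i j k) *+ 2.
  na_comb (- dif (as_comm_cyc charF0 a i j k) + dif (as23 a (nacomm i j) k)
    + dif (as23 a (nacomm j k) i) + dif (as23 a (nacomm k i) j)).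
rewrite psiMn psi_comm //.
suff -> : useq a (- naassoc i j k :: s) = 0 by rewrite !mul0rn.
have Z b c : useq a (nacomm b c :: s) = 0.
  by have := @Nm a [::] b c s; rewrite -sz /= add0n => ->.
have D x y : useq a (x + y :: s) = useq a (x :: s) + useq a (y :: s).
  exact: (useqD charF0 a [::]).
have O x : useq a (- x :: s) = - useq a (x :: s) by exact: (useq_slotN charF0 a [::]).
apply: (mulrnI0 charF0 (n := 5)).
have N x n : useq a (x *+ n :: s) = useq a (x :: s) *+ n.
  by rewrite -!scaler_nat; exact: (useqZ charF0 a [::]).
by rewrite -N mulNrn as_jacobi O D D !Z !addr0 oppr0.
Qed.

End Psi.

(** * Commutators in the arguments of u_m *)

Section CommutatorArguments.
Variables (F : fieldType) (charF0 : [pchar F] =i pred0) (A : altAlgType F).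
Implicit Types (a b c e i j k x y w : A) (p q s t : seq A).
Variable m : nat.
Hypothesis Sm : @u_alt F A m.
Hypothesis Nm : @u_comm0 F A m.-1.

(** The commutator [u_m(q, j), j]; q has length m-1. *)
Definition kappa a j q := nacomm (useq a (q ++ [:: j])) j.
(** The value u_m(s, j, [j, b]); s has length m-2. *)
Definition gamma a j s b := useq a (s ++ [:: j; nacomm j b]).

(** The two moves have opposite parities. *)
Lemma useq_front2_to_end a x y s : (size s).+2 = m ->
  useq a (x :: y :: s) = - useq a (s ++ [:: y; x]).
Proof.
move=> sz; have := @alt_move _ _ _ (useqD charF0 a) _ (Sm a) [::] x (y :: s) [::].
rewrite /= addn0 add0n cats0 => -> //.
have := @alt_move _ _ _ (useqD charF0 a) _ (Sm a) [::] y s [:: x].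
rewrite /= addn1 add0n => -> //.
by rewrite /sgo; case: (odd _); rewrite //= opprK.
Qed.

Lemma useq_swap_ends a x y s : (size s).+2 = m -> useq a (x :: s ++ [:: y]) = - useq a (y :: s ++ [:: x]).
Proof.
move=> sz; have Z z : useq a (z :: s ++ [:: z]) = 0.
  by apply: (@alt_rep _ _ _ (useqD charF0 a) _ (Sm a) [::] z s [::]); rewrite /= addn0.
have := Z (x + y); rewrite (useqD charF0 a [::]) -!cat_cons !(useqD charF0 a (_ :: s)) /=.
by rewrite !Z add0r addr0 => /eqP; rewrite addr_eq0 => /eqP.
Qed.

Lemma gammaD a j s x y : gamma a j s (x + y) = gamma a j s x + gamma a j s y.
Proof. by rewrite /gamma nacommDr -!(cat_rcons j) useqD. Qed.
Lemma gamma_consD a j s x y b : gamma a j (x + y :: s) b = gamma a j (x :: s) b + gamma a j (y :: s) b.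
Proof. exact: (useqD charF0 a [::]). Qed.

Lemma kappa_rcons a j s b : (size s).+2 = m ->
  kappa a j (s ++ [:: b]) = sgo (odd (size s)) (kappa a j (b :: s)).
Proof.
move=> sz; have := @alt_move _ _ _ (useqD charF0 a) _ (Sm a) [::] b s [:: j].
rewrite /kappa -catA /= addn1 add0n => -> //.
by rewrite /sgo; case: (odd _) => //; na_ring.
Qed.

Lemma gamma_rcons a j s b x : (size s).+3 = m ->
  gamma a j (s ++ [:: b]) x = sgo (odd (size s)) (gamma a j (b :: s) x).
Proof.
move=> sz; have := @alt_move _ _ _ (useqD charF0 a) _ (Sm a) [::] b s [:: j; nacomm j x].
rewrite /gamma -catA /= addn2 add0n => -> //.
by rewrite /sgo; case: (odd _); rewrite //= opprK.
Qed.

(** In [u_mid] the pair jj stands before the last letter b; rotating it to the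
    front produces the word jjbs. *)
Lemma u_rep_front a j b s : (size s).+2 = m ->
  useq a (j :: j :: b :: s) *+ 2 =
  sgo (odd (size s)) (kappa a j (b :: s) *+ 2 - gamma a j s b) - kappa a j (b :: s).
Proof.
move=> sz.
have := u_mid charF0 Sm a j b sz; rewrite (u_rotn charF0 Sm) ?addn1 //=.
have sw : useq a (s ++ [:: j; b]) = - useq a ((s ++ [:: b]) ++ [:: j]).
  by rewrite -catA (alt_swap (useqD charF0 a) (Sm a)) //= addn0.
rewrite sw -/(gamma a j s b).
have K := @kappa_rcons a j s b sz; rewrite {1}/kappa in K.
have E : nacomm (useq a [:: b & s ++ [:: j]]) j = kappa a j (b :: s) by [].
rewrite E.
move: K; rewrite /sgo; case: (odd _) => /= K M.
  na_comb (- dif M + dif K).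
na_comb (dif M - dif K).
Qed.

(** Rotating b away from the front of bjjs gives the word jj s_1 s_2 b, where
    s_1 is the first letter of s; [u_rep_front] applies to it. *)
Lemma u_rep_second a j b s : s != [::] -> (size s).+2 = m ->
  useq a (b :: j :: j :: s) *+ 2 =
  sgo (odd (size s)) (kappa a j (b :: s) + gamma a j (behead s ++ [:: b]) (head 0 s))
  - kappa a j (b :: s) *+ 2.
Proof.
case: s => // s1 s2 _ sz; have sz' : (size (s2 ++ [:: b])).+2 = m by rewrite size_cat addn1.
have := @u_rot _ charF0 A m Sm a b [::] j (s1 :: s2) isT; rewrite /= add0n => -> //.
have := @u_rep_front a j s1 (s2 ++ [:: b]) sz'.
have K := @kappa_rcons a j (s1 :: s2) b sz; move: K; rewrite size_cat addn1 /= /sgo.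
by case: (odd _) => /= K E; [na_comb (- dif E - dif K) | na_comb (- dif E + dif K *+ 3)].
Qed.

(** This is [u_rep_front] for the word jjjs, linearised in the first two letters in
    the direction b. *)
Lemma u_rep_polar a j b s : s != [::] -> (size s).+2 = m ->
  (useq a (j :: b :: j :: s) + useq a (b :: j :: j :: s)) *+ 2 =
  sgo (odd (size s)) (gamma a j s b - kappa a j (b :: s) *+ 2) + kappa a j (b :: s).
Proof.
move=> s0 sz; have E1 := @u_rep_front a (j + b) j s sz; have E2 := @u_rep_front a j j s sz.
have E3 := @u_rep_front a b j s sz.
have P : useq a [:: j + b, j + b, j & s] = useq a [:: j, j, j & s] + useq a [:: j, b, j & s]
    + useq a [:: b, j, j & s] + useq a [:: b, b, j & s].
  have D x y t : useq a (x + y :: t) = useq a (x :: t) + useq a (y :: t).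
    exact: (useqD charF0 a [::]).
  have D' z x y t : useq a (z :: x + y :: t) = useq a (z :: x :: t) + useq a (z :: y :: t).
    exact: (useqD charF0 a [:: z]).
  by rewrite D !D' !addrA.
have K : kappa a (j + b) (j :: s) = kappa a j (j :: s) + kappa a b (j :: s) - kappa a j (b :: s).
  rewrite /kappa useqD // [useq a ((b :: s) ++ _)]useq_swap_ends //.
  rewrite [useq a ((j :: s) ++ [:: j])](_ : _ = 0); first by na_ring.
  by apply: (@alt_rep _ _ _ (useqD charF0 a) _ (Sm a) [::] j s [::]); rewrite /= addn0.
have G : gamma a (j + b) s j = gamma a j s j + gamma a b s j - gamma a j s b.
  rewrite /gamma; have -> : nacomm (j + b) j = - nacomm j b by na_ring.
  have -> : nacomm b j = - nacomm j b by na_ring.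
  have -> : nacomm j j = 0 by na_ring.
  have Z : useq a (s ++ [:: j; 0]) = 0.
    by rewrite -cat_rcons -[X in [:: X]](scale0r (0 : A)) useqZ // scale0r.
  rewrite Z useqD // -!(cat_rcons j) -!(cat_rcons b) !useq_slotN //.
  by na_ring.
move: E1 E2 E3; rewrite P K G /sgo; case: (odd _) => /= E1 E2 E3.
  na_comb (dif E1 - dif E2 - dif E3).
na_comb (dif E1 - dif E2 - dif E3).
Qed.

Lemma gamma_front a j b s : s != [::] -> (size s).+2 = m ->
  useq a (j :: b :: j :: s) - useq a (b :: j :: j :: s) = gamma a j s b.
Proof.
move=> s0 sz; rewrite -(useq_comm_rep charF0 Sm Nm) // useq_front2_to_end // /gamma.
have -> : nacomm b j = - nacomm j b by na_ring.
by rewrite -cat_rcons useq_slotN // opprK cat_rcons.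
Qed.

(** Elimination of the values of u_{m+1} from the three preceding relations. *)
Lemma kappa_gamma a j b s : s != [::] -> (size s).+2 = m ->
  gamma a j s b *+ 2 = kappa a j (b :: s) *+ 5 + sgo (odd (size s))
   (gamma a j s b - kappa a j (b :: s) *+ 4 - gamma a j (behead s ++ [:: b]) (head 0 s) *+ 2).
Proof.
move=> s0 sz.
have := gamma_front a j b s0 sz; have := u_rep_polar a j b s0 sz; have := u_rep_second a j b s0 sz.
rewrite /sgo; case: (odd _) => E1 E2 E3.
  na_comb (- dif E1 *+ 2 + dif E2 - dif E3 *+ 2).
na_comb (- dif E1 *+ 2 + dif E2 - dif E3 *+ 2).
Qed.

(** When b is the first letter of s, kappa vanishes and the two values of gamma in
    [kappa_gamma] agree up to sign. *)
Lemma gamma_rep a j b s : (size s).+3 = m -> gamma a j (b :: s) b = 0.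
Proof.
move=> sz; have sz' : (size (b :: s)).+2 = m by [].
have := @kappa_gamma a j b (b :: s) isT sz'; rewrite /= gamma_rcons //.
have -> : kappa a j [:: b, b & s] = 0.
  rewrite /kappa; have := @Sm a [::] b (s ++ [:: j]); rewrite /= size_cat addn1 add0n.
  by move=> -> //; na_ring.
rewrite /sgo; case: (odd _) => /= E.
  na_comb (- dif E).
na_comb (dif E).
Qed.

Lemma gamma_skew a j x y s : (size s).+3 = m -> gamma a j (x :: s) y = - gamma a j (y :: s) x.
Proof.
move=> sz; have := @gamma_rep a j (x + y) s sz.
rewrite gamma_consD !gammaD !gamma_rep // add0r addr0 => /eqP.
by rewrite addr_eq0 => /eqP.
Qed.

(** The identity [useq_comm_cyc] for e, j, b and a word ending in j makes gamma
    symmetric in e and b, whereas it is skew by [gamma_skew]. *)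
Lemma gamma0 a j s b : s != [::] -> (size s).+2 = m -> gamma a j s b = 0.
Proof.
case: s => // e q _ sz.
have szj : (size (q ++ [:: j])).+2 = m by rewrite size_cat addn1.
have q0 : q ++ [:: j] != [::] by case: (q).
have R : useq a [:: nacomm b e, j & q ++ [:: j]] = 0.
  by apply: (@alt_rep _ _ _ (useqD charF0 a) _ (Sm a) [:: nacomm b e] j q [::]); rewrite /= addn0.
have := @useq_comm_cyc _ charF0 _ _ Sm Nm a e j b (q ++ [:: j]) q0 szj.
rewrite R !useq_front2_to_end // -!catA /=.
have E1 : useq a (q ++ [:: j; b; nacomm e j]) = gamma a j (q ++ [:: b]) e.
  have -> : nacomm e j = - nacomm j e by na_ring.
  have -> : q ++ [:: j; b; - nacomm j e] = (q ++ [:: j; b]) ++ [:: - nacomm j e].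
    by rewrite -catA.
  rewrite useq_slotN // -catA /= (alt_swap (useqD charF0 a) (Sm a)).
    by rewrite opprK /gamma -catA.
  by rewrite /= addn1 -sz.
have E2 : useq a (q ++ [:: j; e; nacomm j b]) = - gamma a j (q ++ [:: e]) b.
  rewrite (alt_swap (useqD charF0 a) (Sm a)); first by rewrite /gamma -catA.
  by rewrite /= addn1 -sz.
rewrite E1 E2 !gamma_rcons // (gamma_skew a j e b) // addr0 /sgo.
case: (odd _) => /= E; apply: (mulrnI0 charF0 (n := 1)).
  na_comb (- dif E).
na_comb (dif E).
Qed.

Hypothesis m_gt2 : (2 < m)%N.

(** With gamma = 0 the relation [kappa_gamma] reads 9 kappa = 0 or kappa = 0,
    according to the parity of m. *)
Lemma u_last_step : u_last_comm A m.
Proof.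
move=> a [|b s] j sz; first by move: m_gt2; rewrite -sz.
have s0 : s != [::] by move: m_gt2; rewrite -sz; case: (s).
have := @kappa_gamma a j b s s0 sz; rewrite !gamma0 //; last first.
- by rewrite size_cat size_behead /= addn1 -sz; case: (s) s0.
- by case: (behead s).
rewrite -cats1 -/(kappa a j (b :: s)) /sgo; case: (odd _) => E.
  by apply: (mulrnI0 charF0 (n := 8)); na_comb (- dif E).
na_comb (- dif E).
Qed.

Lemma u_comm0_step : u_comm0 A m.
Proof.
(* The function h is skew in e, j, b and its cyclic sum over them vanishes. *)
pose h a s e j b := useq a (s ++ [:: e; nacomm j b]).
have h0 a s e j b : (size s).+2 = m -> h a s e j b = 0.
  move=> sz; have s0 : s != [::] by move: m_gt2; rewrite -sz; case: (s).
  have hD c x y z : h a s (x + y) c z = h a s x c z + h a s y c z by exact: useqD.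
  have hD' c x y z : h a s c (x + y) z = h a s c x z + h a s c y z.
    by rewrite /h nacommDl -!(cat_rcons c) useqD.
  have h12 x y z : h a s x y z = - h a s y x z.
    have Z c : h a s c c z = 0 by exact: gamma0.
    by have := Z (x + y); rewrite hD !hD' !Z add0r addr0 => /eqP; rewrite addr_eq0 => /eqP.
  have h23 x y z : h a s x y z = - h a s x z y.
    rewrite /h -!(cat_rcons x); have -> : nacomm y z = - nacomm z y by na_ring.
    by rewrite useq_slotN.
  have := @useq_comm_cyc _ charF0 _ _ Sm Nm a e j b s s0 sz.
  rewrite !useq_front2_to_end // -/(h a s b e j) -/(h a s e j b) -/(h a s j b e).
  have R1 : h a s b e j = h a s e j b by rewrite h12 h23 opprK.
  have R2 : h a s j b e = h a s e j b by rewrite h23 h12 opprK.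
  rewrite R1 R2 => E; apply: (mulrnI0 charF0 (n := 2)); na_comb (- dif E).
(* The word has length at least 3, so some letter e stands before the commutator
   once the latter is moved to the end. *)
move=> a p b c q sz.
have := @alt_move _ _ _ (useqD charF0 a) _ (Sm a) p (nacomm b c) q [::].
rewrite addn0 cats0 => -> //.
rewrite catA; move: sz; rewrite -size_cat; move: (p ++ q) => r sz.
case/lastP: r sz => [|s e] sz; first by move: m_gt2; rewrite -sz.
rewrite size_rcons in sz; have := h0 a s e b c sz; rewrite /h cat_rcons => ->.
by rewrite sgo0.
Qed.

End CommutatorArguments.

(** * Values on a generating set *)

Local Open Scope classical_set_scope.

Section Values.
Variables (F : fieldType) (charF0 : [pchar F] =i pred0) (A : altAlgType F).
Implicit Types (a b c e i j k x y w : A) (p q s t : seq A).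

Lemma useq1 a e : useq a [:: e] = 0.
Proof.
rewrite -[[:: e]]/(rcons [::] e) useq_rcons // /defect /=.
have -> : a ** a - jor a a = - (a ** a) by na_ring.
na_comb (dif (as_sqr charF0 a a e) + jor a (dif (naassoc_xxy a e))).
Qed.

Lemma useq_pair a c e : useq a [:: c; e] = 0.
Proof.
rewrite -[[:: c; e]]/(rcons [:: c] e) useq_rcons // /defect /= comm_sqr //.
by na_ring.
Qed.

Lemma u_props n : [/\ u_alt A n, u_comm0 A n & u_last_comm A n].
Proof.
elim: n => [|n [Sn Nn Ln]]; first by split=> [a p c q|a p b c q|a s b].
have [n_gt1|] := ltnP 1 n.
  have Sm := u_alt_step charF0 Sn Nn Ln.
  by split=> //; [apply: u_comm0_step|apply: u_last_step].
have u1 a e : nacomm (useq a [:: e]) e = 0 by rewrite useq1; na_ring.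
have u2 a c e : nacomm (useq a [:: c; e]) e = 0 by rewrite useq_pair; na_ring.
case: n {Sn Nn Ln} => [|[|//]] _.
  by split=> [a [|? ?] c [|? ?]|a [|? ?] b c [|? ?]|a [|? ?] b] //= _; exact: useq1.
split=> [a [|? ?] c [|? ?]|a [|x [|? ?]] b c [|y [|? ?]]|a [|x [|? ?]] b] //= _;
  exact: useq_pair.
Qed.

Lemma useq_alt n : u_alt A n. Proof. by case: (u_props n). Qed.

Lemma useq_comm a p b c q : useq a (p ++ nacomm b c :: q) = 0.
Proof. by case: (u_props (size p + size q).+1) => _ N _; apply: N. Qed.

Lemma useq_to_end a p x q :
  useq a (p ++ x :: q) = sgo (odd (size q)) (useq a (rcons (p ++ q) x)).
Proof.
rewrite -cats1 -catA -{1}[q]cats0.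
by rewrite (alt_move (useqD charF0 a) (@useq_alt (size p + size q).+1 a)) ?addn0.
Qed.

(** The last argument enters through the derivation (r, a, _) only. *)
Lemma useq_jor a s y z :
  useq a (rcons s (jor y z)) = jor y (useq a (rcons s z)) + jor z (useq a (rcons s y)).
Proof.
rewrite !useq_rcons //; set d := defect a s.
na_comb (- dif (as_rot d a (jor y z)) - dif (as_rot a (jor y z) d) - dif (jor_as y z d a)
  + jor y (dif (as_rot d a z) + dif (as_rot a z d))
  + jor z (dif (as_rot d a y) + dif (as_rot a y d))).
Qed.

Section Closure.
Variable (I : set A).
Hypothesis idI : is_ideal I.

Let I0 : I 0. Proof. by case: idI => [[]]. Qed.
Let ID x y : I x -> I y -> I (x + y). Proof. by case: idI => [[_ + _] _]; apply. Qed.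
Let IZ (k : F) x : I x -> I (k *: x). Proof. by case: idI => [[_ _ +] _]; apply. Qed.
Let IN x : I x -> I (- x). Proof. by rewrite -scaleN1r; apply: IZ. Qed.
Let IJ x y : I y -> I (jor x y).
Proof. by case: idI => _ h /h - /(_ x) [h1 h2]; apply: ID. Qed.

Lemma useq_slot_subalgebra a p q :
  is_subalgebra [set y | I (useq a (p ++ y :: q))].
Proof.
have Isgo (b : bool) x : I x -> I (sgo b x) by case: b => //; apply: IN.
have Z0 : useq a (p ++ 0 :: q) = 0.
  by rewrite -[X in p ++ X :: _](scale0r (0 : A)) useqZ // scale0r.
split; [split => [|x y|k x] /=|move=> x y /=].
- by rewrite Z0.
- by rewrite useqD //; apply: ID.
- by rewrite useqZ //; apply: IZ.
rewrite !useq_to_end => Ix Iy; apply: Isgo.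
have unsgo (b : bool) z : I (sgo b z) -> I z by case: b => //= /IN; rewrite opprK.
move/unsgo: Ix; move/unsgo: Iy; set s := p ++ q => Iy Ix.
have two : (2%:R : F) != 0 by move/pcharf0P: charF0 => ->.
have E : useq a (rcons s (x ** y)) *+ 2 =
    jor x (useq a (rcons s y)) + jor y (useq a (rcons s x)).
  rewrite -useq_jor -!cats1 -scaler_nat -useqZ // scaler_nat.
  have -> : (x ** y) *+ 2 = jor x y + nacomm x y by na_ring.
  by rewrite useqD // useq_comm addr0.
have -> : useq a (rcons s (x ** y)) = 2%:R^-1 *: (useq a (rcons s (x ** y)) *+ 2).
  by rewrite -scaler_nat scalerA mulVf // scale1r.
by rewrite E; apply: IZ; apply: ID; apply: IJ.
Qed.

(** An ideal containing the values of u_n(a; _) on a generating family contains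
    all values of u_n(a; _). *)
Lemma useq_gen (K : Type) (g : K -> A) n a :
  subalgebra_gen (range g) = setT ->
  (forall r : seq K, size r = n -> I (useq a (map g r))) ->
  forall t, size t = n -> I (useq a t).
Proof.
move=> gen Ig t szt.
(* Arbitrary arguments are allowed in the last slots q; their number grows. *)
suff H r q : (size r + size q)%N = n -> I (useq a (map g r ++ q)) by exact: (H [::] t).
elim: q r => [|y q IH] r sz; first by rewrite cats0; apply: Ig; rewrite -sz addn0.
have : subalgebra_gen (range g) y by rewrite gen.
move=> /(_ _ (conj (useq_slot_subalgebra a (map g r) q) _)); apply.
move=> _ [k _ <-] /=; rewrite -cat_rcons -map_rcons; apply: IH.
by rewrite size_rcons addSnnS.
Qed.

End Closure.
End Values.

(** Every element of the free algebra is the class of a term in the generators. *)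
Lemma fa_gen_generates (F : fieldType) (X : Type) :
  subalgebra_gen (range (@fa_gen F X)) = setT.
Proof.
apply/seteqP; split=> // + _; elim/fa_ind => t S [[[S0 SD SZ] SM] gS].
elim: t => [i||x IH|x IHx y IHy|c x IH|x IHx y IHy].
- by apply: gS; exists i.
- exact: S0.
- by rewrite -fa_oppE; change (S (- (fa_class x : free_alt F X))); rewrite -scaleN1r; apply: SZ.
- by rewrite -fa_addE; apply: SD.
- by rewrite -fa_scaleE; apply: SZ.
- by rewrite -fa_mulE; apply: SM.
Qed.

Lemma not_uniq_split (K : eqType) (r : seq K) : ~~ uniq r ->
  exists x p q s, r = p ++ x :: q ++ x :: s.
Proof.
elim: r => //= y r IH; rewrite negb_and negbK => /orP[/splitPr[q s]|/IH[x [p [q [s ->]]]]].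
  by exists y, [::], q, s.
by exists x, (y :: p), q, s.
Qed.

Theorem proposition3p1 (F : fieldType) (charF0 : [pchar F] =i pred0)
    (n : nat) (n_gt0 : (0 < n)%N) :
  (forall (a : Alt[X]_F) (t : n.-tuple (Alt[X]_F)),
     ideal_gen [set u_elt a (map_tuple (@fa_gen F nat) i) | i in [set: n.-tuple nat]]
       (u_elt a t))
  /\
  (forall (B : altAlgType F), n_generated B n ->
     forall (a : B) (t : n.+1.-tuple B), u_elt a t = 0).
Proof.
split=> [a t I [idI GI]|B [g gen] a t]; rewrite u_eltE.
  apply: (useq_gen charF0 idI (fa_gen_generates F nat)) (size_tuple t) => r szr.
  by apply: GI; exists (tcast szr (in_tuple r)) => //; rewrite u_eltE /= val_tcast.
have id0 : is_ideal [set 0 : B].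
  split; last by move=> x y ->; rewrite namul0l namul0r.
  by split=> // [x y -> ->|c x ->]; rewrite ?addr0 ?scaler0.
apply: (useq_gen charF0 id0 gen) (size_tuple t) => r szr.
have /not_uniq_split[k [p [q [s Er]]]] : ~~ uniq r.
  apply/negP => r_uniq; have r_enum : {subset r <= enum 'I_n} by move=> k; rewrite mem_enum.
  by have := uniq_leq_size r_uniq r_enum; rewrite szr size_enum_ord ltnn.
rewrite Er map_cat /= map_cat /=.
exact: (alt_rep (useqD charF0 a) (useq_alt charF0 a)) erefl.
Qed.
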